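(* Let $\lambda\in\mathbb{R}$ and let $p$ be a positive integer. Then \[ \Big(x\frac{d}{dx}\Big)_{p,\lambda}e^{x}=\sum_{n=1}^{\infty}\frac{(n)_{p,\lambda}}{n!}x^n=e^{x}\phi_{p,\lambda}(x). \]
   Context: For $\lambda\in\mathbb{R}$, the generalized falling factorials are $(x)_{0,\lambda}=1$ and $(x)_{n,\lambda}=x(x-\lambda)(x-2\lambda)\cdots(x-(n-1)\lambda)$ for $n\ge 1$. The degenerate differential operator is $\big(x\frac{d}{dx}\big)_{n,\lambda}=\big(x\frac{d}{dx}\big)\big(x\frac{d}{dx}-\lambda\big)\cdots\big(x\frac{d}{dx}-(n-1)\lambda\big)$ for $n\ge1$. The degenerate exponential is the formal power series $e_\lambda(t)=\sum_{n\ge 0}(1)_{n,\lambda}\frac{t^n}{n!}$. The degenerate Bell polynomials $\phi_{n,\lambda}(x)$ are defined by $e^{x(e_\lambda(t)-1)}=\sum_{n=0}^{\infty}\phi_{n,\lambda}(x)\frac{t^n}{n!}$ (as formal power series in $t$). *)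

(* Defs.v *)
From HB Require Import structures.
From mathcomp Require Import all_boot all_order all_algebra.
From mathcomp Require Import all_classical all_reals all_analysis.

Set Implicit Arguments.
Unset Strict Implicit.
Unset Printing Implicit Defensive.

Import Order.TTheory GRing.Theory Num.Theory.
Import numFieldNormedType.Exports.

Local Open Scope ring_scope.

Definition gfalling {A : pzRingType} (lambda x : A) (n : nat) : A :=
  \prod_(k < n) (x - lambda *+ k).

Definition euler_op {R : realType} (f : R -> R) : R -> R :=
  fun x => x * derive1 f x.

(* The rightmost factor of the product, theta - (n-1) lambda, acts first. *)
Fixpoint degen_euler_op {R : realType} (lambda : R) (n : nat) (f : R -> R)
    {struct n} : R -> R :=
  if n is m.+1 then
    degen_euler_op lambda m (fun x => euler_op f x - (lambda *+ m) * f x)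
  else f.

(* A formal power series in t is encoded by its sequence of coefficients. *)
Definition fps (A : Type) : Type := nat -> A.

Definition fps_one {A : pzRingType} : fps A := fun n => (n == 0%N)%:R.

Definition fps_mul {A : pzRingType} (f g : fps A) : fps A :=
  fun n => \sum_(i < n.+1) f i * g (n - i)%N.

Definition fps_pow {A : pzRingType} (f : fps A) (k : nat) : fps A :=
  iter k (fps_mul f) fps_one.

(* The series sum_k f^k / k!, meaningful when f has zero constant term: then
   f^k has no terms of degree < k (see fps_pow_lt), so that truncating the sum
   at k = n does not change the coefficient of t^n. *)
Definition fps_exp {R : numFieldType} {A : lalgType R} (f : fps A) : fps A :=
  fun n => \sum_(k < n.+1) (k`!%:R : R)^-1 *: fps_pow f k n.

Lemma fps_pow_lt {A : pzRingType} (f : fps A) (k n : nat) :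
  f 0%N = 0 -> (n < k)%N -> fps_pow f k n = 0.
Proof.
move=> f0; elim: k n => [//|k IHk] n ltnk.
rewrite /fps_pow iterS -/(fps_pow f k) /fps_mul big1 // => -[[|i] lti] _ /=.
  by rewrite f0 mul0r.
rewrite ltnS in lti; rewrite ltnS in ltnk; rewrite IHk ?mulr0 //.
by apply: leq_trans ltnk; rewrite ltn_subrL (leq_trans _ lti).
Qed.

Definition degen_exp {R : numFieldType} (lambda : R) : fps R :=
  fun n => gfalling lambda 1 n / n`!%:R.

(* x (e_lambda(t) - 1), a power series in t over the polynomials in x. *)
Definition degen_bell_exponent {R : numFieldType} (lambda : R) : fps {poly R} :=
  fun n => 'X * (degen_exp lambda n - fps_one n)%:P.

Lemma degen_bell_exponent0 {R : numFieldType} (lambda : R) :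
  degen_bell_exponent lambda 0 = 0.
Proof.
by rewrite /degen_bell_exponent /degen_exp /gfalling big_ord0 divr1 subrr mulr0.
Qed.

Definition degen_bell {R : numFieldType} (lambda : R) (n : nat) : {poly R} :=
  (n`!%:R : R) *: fps_exp (degen_bell_exponent lambda) n.

(* Main.v *)
(* With theta = x d/dx, theta (e^x b) = e^x x (b + b') for a polynomial b.  To b
   we associate its Newton values n |-> sum_k b_k n(n-1)...(n-k+1); then
   sum_n (value at n) x^n / n! = e^x b(x), and b |-> x (b + b') - c b multiplies
   the value at n by n - c.  So the degenerate operator maps e^x to e^x b where b
   has the values (n)_{p,lambda}.  The Bell polynomial has the same values: by
   the binomial theorem its n-th value is p! [t^p] (1 + (e_lambda - 1))^n, which
   is (n)_{p,lambda} by the Vandermonde identity. *)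
Require Import Defs.
From HB Require Import structures.
From mathcomp Require Import all_boot all_order all_algebra.
From mathcomp Require Import all_classical all_reals all_analysis.
From mathcomp Require Import ring.

Set Implicit Arguments.
Unset Strict Implicit.
Unset Printing Implicit Defensive.

Import Order.TTheory GRing.Theory Num.Theory.
Import numFieldNormedType.Exports.

Local Open Scope classical_set_scope.
Local Open Scope ring_scope.

Lemma gfallingS (A : pzRingType) (lambda x : A) (n : nat) :
  gfalling lambda x n.+1 = gfalling lambda x n * (x - lambda *+ n).
Proof. by rewrite /gfalling big_ord_recr. Qed.

(** Vandermonde identity: the new factor splits as (x - i lambda) + (y - (n - i) lambda), each half
    extends one of the two products, and Pascal's rule recombines the sums. *)
Lemma gfallingD (A : comPzRingType) (lambda x y : A) (n : nat) :
  gfalling lambda (x + y) n =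
  \sum_(i < n.+1) (gfalling lambda x i * gfalling lambda y (n - i)) *+ 'C(n, i).
Proof.
elim: n => [|n IHn].
  by rewrite big_ord1 /gfalling !big_ord0 mulr1.
pose a i : A := gfalling lambda x i; pose b i : A := gfalling lambda y i.
rewrite gfallingS {}IHn mulr_suml.
transitivity (\sum_(i < n.+1) ((a i.+1 * b (n - i)%N) *+ 'C(n, i) +
                               (a i * b (n.+1 - i)%N) *+ 'C(n, i))).
  apply: eq_bigr => i _; have lein : (i <= n)%N by rewrite -ltnS.
  rewrite subSn // /a /b !gfallingS -mulrnDl mulrnAl; congr (_ *+ _).
  have -> : x + y - lambda *+ n = (x - lambda *+ i) + (y - lambda *+ (n - i)).
    by rewrite -{1}(subnKC lein) mulrnDr opprD addrACA.
  by ring.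
rewrite big_split /= [RHS]big_ord_recl /= bin0 subn0 mulr1n.
under [in RHS]eq_bigr => i _ do rewrite /bump /= add1n binS mulrnDr subSS.
rewrite big_split /= addrA addrC; congr (_ + _).
(* The ranges agree because the top term carries 'C(n, n+1) = 0. *)
by rewrite big_ord_recl [in RHS]big_ord_recr /= bin0 subn0 bin_small // mulr0n addr0.
Qed.

Lemma fps_powS (A : pzRingType) (f : fps A) (k n : nat) :
  fps_pow f k.+1 n = \sum_(i < n.+1) f i * fps_pow f k (n - i)%N.
Proof. by []. Qed.

(** Coefficients of a power up to degree m see only those of f up to m; truncating f makes
    polynomial algebra, such as the binomial theorem, available. *)
Lemma fps_pow_coef (A : nzRingType) (f : fps A) (m k n : nat) :
  (n <= m)%N -> fps_pow f k n = ((\poly_(i < m.+1) f i) ^+ k)`_n.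
Proof.
elim: k n => [|k IHk] n lenm; first by rewrite expr0 coef1.
rewrite fps_powS exprS coefM; apply: eq_bigr => i _.
have leim : (i <= m)%N by apply: leq_trans lenm; rewrite -ltnS.
by rewrite coef_poly ltnS leim IHk // (leq_trans (leq_subr _ _)).
Qed.

Lemma fps_pow_binomial (A : nzRingType) (f : fps A) (m n : nat) :
  fps_pow f n m =
  \sum_(k < n.+1) fps_pow (fun i => f i - fps_one i) k m *+ 'C(n, k).
Proof.
rewrite (fps_pow_coef _ _ (leqnn m)).
pose g := \poly_(i < m.+1) (f i - fps_one i).
have -> : \poly_(i < m.+1) f i = 1 + g.
  apply/polyP => i; rewrite coefD !coef_poly coef1 /fps_one.
  by case: ltnP => [_|]; [rewrite addrC subrK | case: i => // i _; rewrite addr0].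
rewrite exprDn_comm; last exact: commr_sym (commr1 _).
rewrite coef_sum; apply: eq_bigr => k _.
by rewrite expr1n mul1r coefMn -fps_pow_coef.
Qed.

(** Multiplying by one more degenerate exponential is Vandermonde for 1 + n. *)
Lemma degen_exp_pow (R : numFieldType) (lambda : R) (n m : nat) :
  fps_pow (degen_exp lambda) n m = gfalling lambda n%:R m / m`!%:R.
Proof.
elim: n m => [|n IHn] m.
  case: m => [|m]; first by rewrite /gfalling big_ord0 divr1.
  by rewrite /gfalling big_ord_recl /= mulr0n subr0 !mul0r.
rewrite fps_powS -natr1 addrC gfallingD mulr_suml; apply: eq_bigr => i _.
have leim : (i <= m)%N by rewrite -ltnS.
rewrite IHn /degen_exp -mulr_natr -(bin_fact leim) !natrM.
have fact_neq0 k : k`!%:R != 0 :> R by rewrite pnatr_eq0 -lt0n fact_gt0.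
have bin_neq0 : 'C(m, i)%:R != 0 :> R by rewrite pnatr_eq0 -lt0n bin_gt0.
by field; rewrite !fact_neq0 bin_neq0.
Qed.

Lemma fps_pow_mulX (R : comNzRingType) (g : fps R) (k n : nat) :
  fps_pow (fun i => 'X * (g i)%:P) k n = 'X^k * (fps_pow g k n)%:P.
Proof.
elim: k n => [|k IHk] n; first by rewrite mul1r /fps_pow /= /fps_one polyC_natr.
rewrite !fps_powS rmorph_sum mulr_sumr; apply: eq_bigr => i _ /=.
by rewrite IHk polyCM exprS; ring.
Qed.

Lemma coef_degen_bell (R : numFieldType) (lambda : R) (p k : nat) :
  (degen_bell lambda p)`_k =
  p`!%:R / k`!%:R * fps_pow (fun i => degen_exp lambda i - fps_one i) k p.
Proof.
set g := fun i => _; have g0 : g 0%N = 0.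
  by rewrite /g /degen_exp /gfalling big_ord0 divr1 subrr.
rewrite /degen_bell /fps_exp coefZ coef_sum -mulrA; congr (_ * _).
under eq_bigr => i _ do
  rewrite /degen_bell_exponent fps_pow_mulX coefZ coefMC coefXn.
(* For k > p both sides vanish: the truncated exponential stops at X^p, and g^k has order at least
   k. *)
have [ltpk|lekp] := ltnP p k.
  rewrite fps_pow_lt // mulr0 big1 // => i _.
  by rewrite gtn_eqF ?mul0r ?mulr0 // (leq_trans (ltn_ord i)).
rewrite (bigD1 (Ordinal (lekp : k < p.+1)%N)) //= eqxx mul1r big1 ?addr0 // => i.
by rewrite -val_eqE /= eq_sym => /negPf ->; rewrite mul0r mulr0.
Qed.

Definition newton {R : nzRingType} (b : {poly R}) (n : nat) : R :=
  \sum_(k < n.+1) b`_k * (n ^_ k)%:R.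

Lemma newton_degen_bell (R : numFieldType) (lambda : R) (p n : nat) :
  newton (degen_bell lambda p) n = gfalling lambda n%:R p.
Proof.
have fact_neq0 k : k`!%:R != 0 :> R by rewrite pnatr_eq0 -lt0n fact_gt0.
transitivity (p`!%:R * fps_pow (degen_exp lambda) n p); last first.
  by rewrite degen_exp_pow; field; rewrite fact_neq0.
rewrite fps_pow_binomial mulr_sumr; apply: eq_bigr => k _.
rewrite coef_degen_bell -bin_ffact natrM -mulr_natr.
by field; rewrite fact_neq0.
Qed.

(** This rests on n (n ^_ k) = n ^_ (k+1) + k (n ^_ k): multiplication by X gives the first term, X
    d/dX the second. *)
Lemma newton_euler (R : comNzRingType) (b : {poly R}) (c : R) (n : nat) :
  newton ('X * (b + b^`()) - c *: b) n = (n%:R - c) * newton b n.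
Proof.
rewrite mulrBl /newton !mulr_sumr -sumrB.
transitivity (\sum_(k < n.+1) (('X * b)`_k * (n ^_ k)%:R +
    ((b`_k *+ k) * (n ^_ k)%:R - c * (b`_k * (n ^_ k)%:R)))).
  apply: eq_bigr => -[[|k] ltk] _ /=; rewrite coefB coefZ mulrDr !coefD !coefXM /=.
    by rewrite mulr0n; ring.
  by rewrite coef_deriv; ring.
rewrite big_split /= big_ord_recl coefXM mul0r add0r.
under [X in X + _ = _]eq_bigr => k _ do rewrite coefXM lift0 /=.
have -> : \sum_(k < n) b`_k * (n ^_ k.+1)%:R =
          \sum_(k < n.+1) b`_k * (n ^_ k.+1)%:R.
  by rewrite big_ord_recr /= ffact_small // mulr0 addr0.
rewrite -big_split; apply: eq_bigr => k _ /=.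
have lekn : (k <= n)%N by rewrite -ltnS.
rewrite ffactnSr natrM natrB // -mulr_natr; ring.
Qed.

Lemma cvg_newton_series (R : realType) (b : {poly R}) (x : R) :
  (fun N : nat =>
     \sum_(0 <= n < N) newton b n / n`!%:R * x ^+ n) @ \oo -->
  expR x * b.[x].
Proof.
(* A range independent of n lets the two sums be exchanged, leaving finitely many series, one for
   each k. *)
have newtonE n : newton b n = \sum_(k < size b) b`_k * (n ^_ k)%:R.
  pose m := maxn n.+1 (size b).
  rewrite /newton (big_ord_widen m (fun k => b`_k * (n ^_ k)%:R)) ?leq_maxl //.
  rewrite [RHS](big_ord_widen m (fun k => b`_k * (n ^_ k)%:R)) ?leq_maxr //.
  rewrite big_mkcond [RHS]big_mkcond; apply: eq_bigr => k _ /=.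
  case: ltnP => [_|ltnk]; case: ltnP => [_|lek] //.
    by rewrite nth_default // mul0r.
  by rewrite ffact_small // mulr0.
have cvg_ffact k :
    (fun N : nat => \sum_(0 <= n < N) (n ^_ k)%:R / n`!%:R * x ^+ n) @ \oo -->
    expR x * x ^+ k.
  (* The first k terms are zero, and (n+k) ^_ k / (n+k)! = 1 / n!, so the shifted series is x^k
     times the exponential one. *)
  rewrite -(cvg_shiftn k).
  have -> : (fun N => \sum_(0 <= n < N + k) (n ^_ k)%:R / n`!%:R * x ^+ n) =
            (fun N => series (exp_coeff x) N * x ^+ k).
    apply/funext => N; rewrite /series /= mulr_suml.
    rewrite (big_cat_nat (n := k)) ?leq_addl //= big_nat big1 ?add0r; last first.
      by move=> n /andP[_ ltnk]; rewrite ffact_small // !mul0r.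
    rewrite -{1}(add0n k) big_addn addnK; apply: eq_bigr => n _.
    rewrite /exp_coeff /= -[in (_ + k)`!](ffact_fact (leq_addl n k)) addnK natrM exprD.
    have ffact_neq0 : ((n + k) ^_ k)%:R != 0 :> R.
      by rewrite pnatr_eq0 -lt0n ffact_gt0 leq_addl.
    have fact_neq0 : n`!%:R != 0 :> R by rewrite pnatr_eq0 -lt0n fact_gt0.
    by field; rewrite fact_neq0.
  by apply: cvgM; [exact: is_cvg_series_exp_coeff | exact: cvg_cst].
have -> : (fun N : nat =>
    \sum_(0 <= n < N) newton b n / n`!%:R * x ^+ n) =
  (fun N : nat => \sum_(k < size b)
     b`_k * \sum_(0 <= n < N) (n ^_ k)%:R / n`!%:R * x ^+ n).
  apply/funext => N.
  under [RHS]eq_bigr => k _ do rewrite mulr_sumr.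
  rewrite exchange_big /=; apply: eq_bigr => n _.
  rewrite newtonE !mulr_suml; apply: eq_bigr => k _.
  by rewrite !mulrA.
rewrite horner_coef mulr_sumr.
under eq_bigr => k _ do rewrite mulrCA.
apply: cvg_big => [|k _]; first exact: add_continuous.
apply: cvgM; first exact: cvg_cst.
exact: cvg_ffact.
Qed.

Lemma euler_op_expR (R : realType) (b : {poly R}) (c : R) :
  (fun x => euler_op (fun y => expR y * b.[y]) x - c * (expR x * b.[x])) =
  (fun x => expR x * ('X * (b + b^`()) - c *: b).[x]).
Proof.
apply/funext => x; rewrite /euler_op.
rewrite derive1E derive_val.
by rewrite !hornerE /= /GRing.scale /=; ring.
Qed.

(** Only the Newton values of c matter later, so c stays implicit. The induction varies b because
    the factor acting first changes it. *)
Lemma degen_euler_op_expR (R : realType) (lambda : R) (p : nat) (b : {poly R}) :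
  exists c : {poly R},
    degen_euler_op lambda p (fun x => expR x * b.[x]) =
      (fun x => expR x * c.[x]) /\
    forall n, newton c n = gfalling lambda n%:R p * newton b n.
Proof.
elim: p b => [|p IHp] b /=.
  by exists b; split=> // n; rewrite /gfalling big_ord0 mul1r.
rewrite euler_op_expR; have [c [-> cE]] := IHp ('X * (b + b^`()) - (lambda *+ p) *: b).
by exists c; split=> // n; rewrite cE newton_euler gfallingS mulrA.
Qed.

Theorem theorem5 (R : realType) (lambda : R) (p : nat) (hp : (0 < p)%N) (x : R) :
  let u : R^nat := fun n => gfalling lambda n%:R p / n`!%:R * x ^+ n in
  [/\ cvgn (fun N : nat => \sum_(1 <= n < N) u n),
      degen_euler_op lambda p expR x = \big[+%R/0]_(1 <= n <oo) u n &
      \big[+%R/0]_(1 <= n <oo) u n = expR x * (degen_bell lambda p).[x]].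
Proof.
move=> u.
(* As p > 0, the product for n = 0 contains the factor 0, so starting the sum at 1 loses nothing. *)
have u0 : u 0%N = 0.
  by case: p hp @u => // q _ u; rewrite /u /gfalling big_ord_recl mulr0n subr0 !mul0r.
(* The Newton values alone fix the limit, so the Bell polynomial and c need no direct comparison:
   uniqueness of limits identifies the two functions. *)
have cvgu (b : {poly R}) :
    (forall n, newton b n = gfalling lambda n%:R p) ->
    (fun N : nat => \sum_(1 <= n < N) u n) @ \oo --> expR x * b.[x].
  move=> bE; rewrite -cvg_shiftS.
  have -> : (fun N => \sum_(1 <= n < N.+1) u n) =
      (fun N => \sum_(0 <= n < N.+1) newton b n / n`!%:R * x ^+ n).
    apply/funext => N; rewrite big_add1 [RHS]big_nat_recl //= bE -/(u 0%N) u0 add0r.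
    by under [RHS]eq_bigr => n _ do rewrite bE.
  rewrite (cvg_shiftS (fun N =>
    \sum_(0 <= n < N) newton b n / n`!%:R * x ^+ n)).
  exact: cvg_newton_series.
have bell_cvg := cvgu _ (newton_degen_bell lambda p).
(* The start is b = 1, whose Newton values are all 1. *)
have [c [opE cE]] := degen_euler_op_expR lambda p 1.
have op_cvg : (fun N : nat => \sum_(1 <= n < N) u n) @ \oo -->
    degen_euler_op lambda p expR x.
  have <- : (fun y : R => expR y * (1 : {poly R}).[y]) = expR.
    by apply/funext => y; rewrite hornerC mulr1.
  rewrite opE; apply: cvgu => n.
  rewrite cE /newton big_ord_recl coef1 big1 ?addr0 ?mulr1 //.
  by move=> i _; rewrite coef1 mul0r.
split; first exact: cvgP bell_cvg.
- by apply/esym/cvg_lim.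
- exact/cvg_lim.
Qed.
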